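(* Let $\kappa$ be an infinite cardinal and let $G$ be a topological gyrogroup. If $G$ has one of the following properties, then $G^{\bullet}$ has the same property: (1) $G$ is metrizable; (2) $G$ has a local base at the identity of cardinality $\le\kappa$; (3) $G$ has a network of cardinality $\le\kappa$; (4) $G$ has a dense subset of cardinality $\le\kappa$; (5) $G$ is $\kappa$-narrow.
   Context: A gyrogroup is a set $G$ with a binary operation $\oplus$ such that: (G1) there is a unique identity $0$ with $0\oplus a=a=a\oplus 0$; (G2) each $x$ has a unique inverse $\ominus x$ with $\ominus x\oplus x=0=x\oplus(\ominus x)$; (G3) for all $x,y$ there is an automorphism $\mathrm{gyr}[x,y]$ of $(G,\oplus)$ with $x\oplus(y\oplus z)=(x\oplus y)\oplus \mathrm{gyr}[x,y](z)$ for all $z$; (G4) $\mathrm{gyr}[x\oplus y,y]=\mathrm{gyr}[x,y]$. A topological gyrogroup is a gyrogroup with a topology (all spaces are assumed $T_1$) such that $\oplus$ is jointly continuous and $x\mapsto\ominus x$ is continuous. A network of a space $X$ is a family $\mathcal{P}$ of subsets such that for every $x\in X$ and open $U\ni x$ there is $P\in\mathcal{P}$ with $x\in P\subseteq U$. A topological gyrogroup $G$ is left (right) $\kappa$-narrow if for every neighbourhood $U$ of $0$ there is $K\subseteq G$ with $|K|\le\kappa$ and $K\oplus U=G$ (resp. $U\oplus K=G$); it is $\kappa$-narrow if it is both left and right $\kappa$-narrow. Construction: let $J=[0,1)$ and let $G^{\bullet}$ be the set of all functions $f:J\to G$ for which there exist $0=a_0<a_1<\dots<a_n=1$ with $f$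 constant on each $[a_k,a_{k+1})$, with pointwise operation $(f\oplus^{\bullet}g)(r)=f(r)\oplus g(r)$. For an open neighbourhood $V$ of $0$ in $G$ and $\varepsilon>0$ let $O(V,\varepsilon)=\{f\in G^{\bullet}:\mu(\{r\in J: f(r)\notin V\})<\varepsilon\}$, $\mu$ Lebesgue measure. $G^{\bullet}$ carries the topological gyrogroup topology in which the sets $f\oplus^{\bullet}O(V,\varepsilon)$ form a local base at each $f\in G^{\bullet}$. *)

(* Defs.v *)
From HB Require Import structures.
From mathcomp Require Import all_boot all_order all_algebra.
From mathcomp Require Import all_classical all_reals all_analysis.
Set Implicit Arguments. Unset Strict Implicit. Unset Printing Implicit Defensive.
Import Order.TTheory GRing.Theory Num.Theory.
Local Open Scope classical_set_scope.
Local Open Scope ring_scope.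

Definition is_gyrogroup (G : Type) (op : G -> G -> G) (e : G) (inv : G -> G)
  (gyr : G -> G -> G -> G) : Prop :=
  [/\
      (forall a, op e a = a /\ op a e = a) /\
      (forall e', (forall a, op e' a = a /\ op a e' = a) -> e' = e),
      (forall x, op (inv x) x = e /\ op x (inv x) = e) /\
      (forall x y, op y x = e /\ op x y = e -> y = inv x),
      (forall x y, bijective (gyr x y) /\
                   (forall a b, gyr x y (op a b) = op (gyr x y a) (gyr x y b))),
      (forall x y z, op x (op y z) = op (op x y) (gyr x y z)) &
      (forall x y, gyr (op x y) y = gyr x y)].

(* A topological gyrogroup; all spaces are assumed T1. *)
Definition is_topological_gyrogroup (G : topologicalType) (op : G -> G -> G)
  (e : G) (inv : G -> G) (gyr : G -> G -> G -> G) : Prop :=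
  [/\ is_gyrogroup op e inv gyr,
      continuous (fun p : G * G => op p.1 p.2),
      continuous inv &
      @accessible_space G].

(* ---------- Generic space notions, for a space given by a carrier set S ----
   of a type T together with its family of open sets opn (opens are subsets
   of S).  For a topological space G we use S = setT and opn = open. ------- *)

Definition metrizable_sp (R : realType) (T : Type) (S : set T)
  (opn : set T -> Prop) : Prop :=
  exists d : T -> T -> R,
    [/\ (forall x y, S x -> S y -> 0 <= d x y),
        (forall x y, S x -> S y -> (d x y = 0 <-> x = y)),
        (forall x y, S x -> S y -> d x y = d y x),
        (forall x y z, S x -> S y -> S z -> d x z <= d x y + d y z) &
        (forall U, opn U <-> (U `<=` S /\
            forall x, U x -> exists2 r : R, 0 < r &
               [set y | S y /\ d x y < r] `<=` U))].

Definition is_local_base (T : Type) (opn : set T -> Prop) (x : T)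
  (B : set (set T)) : Prop :=
  (forall W, B W -> opn W /\ W x) /\
  (forall U, opn U -> U x -> exists2 W, B W & W `<=` U).

Definition local_base_card_le (K : Type) (T : Type) (opn : set T -> Prop)
  (x : T) : Prop :=
  exists B : set (set T), is_local_base opn x B /\ card_le B [set: K].

Definition is_network (T : Type) (opn : set T -> Prop) (P : set (set T)) : Prop :=
  forall x U, opn U -> U x -> exists2 A, P A & A x /\ A `<=` U.

Definition network_card_le (K : Type) (T : Type) (opn : set T -> Prop) : Prop :=
  exists P : set (set T), is_network opn P /\ card_le P [set: K].

Definition dense_card_le (K : Type) (T : Type) (S : set T)
  (opn : set T -> Prop) : Prop :=
  exists D : set T, [/\ D `<=` S,
    (forall U, opn U -> U !=set0 -> (U `&` D) !=set0) & card_le D [set: K]].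

Definition is_nbhd (T : Type) (S : set T) (opn : set T -> Prop) (x : T)
  (U : set T) : Prop :=
  U `<=` S /\ exists2 W, opn W & W x /\ W `<=` U.

Definition left_narrow (K : Type) (T : Type) (S : set T) (opn : set T -> Prop)
  (op : T -> T -> T) (e : T) : Prop :=
  forall U, is_nbhd S opn e U ->
    exists Ks : set T, [/\ Ks `<=` S, card_le Ks [set: K] &
      [set op k u | k in Ks & u in U] = S].

Definition right_narrow (K : Type) (T : Type) (S : set T) (opn : set T -> Prop)
  (op : T -> T -> T) (e : T) : Prop :=
  forall U, is_nbhd S opn e U ->
    exists Ks : set T, [/\ Ks `<=` S, card_le Ks [set: K] &
      [set op u k | u in U & k in Ks] = S].

Definition narrow (K : Type) (T : Type) (S : set T) (opn : set T -> Prop)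
  (op : T -> T -> T) (e : T) : Prop :=
  left_narrow K S opn op e /\ right_narrow K S opn op e.

Definition J (R : realType) := {r : R | 0 <= r < 1}.

Definition is_step (R : realType) (G : Type) (f : J R -> G) : Prop :=
  exists (n : nat) (a : nat -> R),
    [/\ a 0%N = 0, a n = 1,
        (forall k, (k < n)%N -> a k < a k.+1) &
        (forall k, (k < n)%N -> forall r s : J R,
            a k <= sval r < a k.+1 -> a k <= sval s < a k.+1 -> f r = f s)].

Definition Gbul (R : realType) (G : Type) : set (J R -> G) := [set f | is_step f].
Arguments Gbul R G : clear implicits.

Definition opbul (R : realType) (G : Type) (op : G -> G -> G)
  (f g : J R -> G) : J R -> G := fun r => op (f r) (g r).

Definition const_bul (R : realType) (G : Type) (e : G) : J R -> G := fun _ => e.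
Arguments const_bul R {G} e.

Definition Obul (R : realType) {G : Type} (V : set G) (eps : R) : set (J R -> G) :=
  [set f | Gbul R G f /\
     (lebesgue_measure (sval @` [set r : J R | ~ V (f r)]) < eps%:E)%E].

Arguments Obul R {G} V eps.

(* The topology of G^bullet: the sets f (+) O(V, eps) (V an open nbhd of 0 in
   G, eps > 0) form a local base at each f; i.e. U is open iff U is a subset
   of G^bullet containing such a basic set around each of its points. *)
Definition open_bul (R : realType) {G : topologicalType} (op : G -> G -> G)
  (e : G) (U : set (J R -> G)) : Prop :=
  U `<=` Gbul R G /\
  forall f, U f -> exists V : set G, exists2 eps : R,
     [/\ open V, V e & 0 < eps] &
     [set opbul op f h | h in Obul R V eps] `<=` U.
Arguments open_bul R {G} op e U.

(* Main.v *)
Require Import Defs.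
From HB Require Import structures.
From mathcomp Require Import all_boot all_order all_algebra.
From mathcomp Require Import all_classical all_reals all_analysis.
From mathcomp Require Import lra.
Set Implicit Arguments. Unset Strict Implicit. Unset Printing Implicit Defensive.
Import Order.TTheory GRing.Theory Num.Theory.
Local Open Scope classical_set_scope.

(* Left translations of G are homeomorphisms and a step function f takes
   finitely many values, so the topology of G^bullet is that of convergence in
   measure: g is close to f when g(r) lies in a prescribed neighbourhood of f(r)
   for all r outside a set of small measure. Hence a metric d of G yields the
   Ky Fan metric inf {t >= 0 | mu {d(f, g) > t} <= t} on G^bullet.
   For the cardinality properties, f(r) agrees with f(floor(N r)/N) outside a
   set of measure at most (number of jumps)/N. So f is approximated by functions
   constant on the cells [k/N, (k+1)/N), which are coded by N and a finite
   sequence of elements of K, and an infinite K has only |K| such codes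
   because |K * K| <= |K|. For right narrowness one must also solve x + a = b
   at the exceptional points; this follows from the left Bol identity. *)

(** * Finite sequences over an infinite set *)

(** Zorn's lemma for partial maps, coded as a domain together with a total function whose values
    matter only on that domain. The second hypothesis says that [P] is tested on two points at a
    time; a chain has a member containing both, so its union again satisfies [P]. *)
Lemma maximal_partial_map (U W : Type) (P : set U -> (U -> W) -> Prop)
    (D0 : set U) (f0 : U -> W) :
  P D0 f0 ->
  (forall D f,
    (forall u v, D u -> D v -> exists D' f',
      [/\ P D' f', D' `<=` D, D' u, D' v & forall x, D' x -> f x = f' x]) ->
    P D f) ->
  exists D f, [/\ P D f, D0 `<=` D &
    forall D' f', P D' f' -> D `<=` D' -> (forall x, D x -> f' x = f x) ->
      D' `<=` D].
Proof.
move=> P0 Pdir.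
pose T := {p : set U * (U -> W) | P p.1 p.2 /\ D0 `<=` p.1}.
pose R (s t : T) := `[< (sval s).1 `<=` (sval t).1 /\
  forall x, (sval s).1 x -> (sval t).2 x = (sval s).2 x >].
have t0 : T by exact: (exist _ (D0, f0) (conj P0 (fun=> id))).
have [||C Ctot|[[D f] /= [PDf D0D]] Dmax] := @ZL_preorder T t0 R.
- by move=> t; apply/asboolP; split.
- move=> r s t /asboolP[rs rs'] /asboolP[st st']; apply/asboolP; split.
    exact: subset_trans st.
  by move=> x rx; rewrite st' ?rs'//; exact: rs.
- have [[s0 Cs0]|C0] := pselect (C !=set0); last first.
    by exists t0 => s Cs; exfalso; apply: C0; exists s.
  pose D := \bigcup_(s in C) (sval s).1.
  have Dx x : exists s, D x -> C s /\ (sval s).1 x.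
    have [[s Cs sx]|Dx] := pselect (D x); first by exists s.
    by exists s0 => /Dx.
  have [c cP] := choice Dx.
  pose f x := (sval (c x)).2 x.
  have fE s x : C s -> (sval s).1 x -> f x = (sval s).2 x.
    move=> Cs sx; have [|Cc cx] := cP x; first by exists s.
    rewrite /f; have [/asboolP[_ ->]//|/asboolP[_ ->]//] := Ctot _ _ Cs Cc.
  have PD : P D f.
    apply: Pdir => u v [s Cs su] [t Ct tv].
    have [w [Cw wu wv]] : exists w, [/\ C w, (sval w).1 u & (sval w).1 v].
      have [/asboolP[st _]|/asboolP[ts _]] := Ctot _ _ Cs Ct.
        by exists t; split => //; exact: st.
      by exists s; split => //; exact: ts.
    exists (sval w).1, (sval w).2; split=> //; first exact: (svalP w).1.
      by move=> x wx; exists w.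
    by move=> x; exact: fE.
  have D0D : D0 `<=` D.
    by move=> x D0x; exists s0 => //; exact: (svalP s0).2.
  exists (exist _ (D, f) (conj PD D0D)) => s Cs; apply/asboolP; split => /=.
    by move=> x sx; exists s.
  by move=> x; exact: fE.
- exists D, f; split => // D' f' PD' DD' ff'.
  have D0D' := subset_trans D0D DD'.
  have /(Dmax (exist _ (D', f') (conj PD' D0D'))) : R
    (exist _ (D, f) (conj PDf D0D)) (exist _ (D', f') (conj PD' D0D')).
    by apply/asboolP; split.
  by case/asboolP.
Qed.

(** Comparability of cardinals: a maximal partial injection either is defined on all of [X] or hits
    all of [Y], and then its inverse serves. Values lie in [option] because [L] may be empty. *)
Lemma set_inj_total (K L : Type) (X : set K) (Y : set L) :
  (exists f : K -> option L, (forall x, X x -> exists2 y, f x = Some y & Y y) /\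
     (forall x x', X x -> X x' -> f x = f x' -> x = x')) \/
  (exists g : L -> option K, (forall y, Y y -> exists2 x, g y = Some x & X x) /\
     (forall y y', Y y -> Y y' -> g y = g y' -> y = y')).
Proof.
pose P (D : set K) (f : K -> option L) :=
  [/\ D `<=` X, forall x, D x -> exists2 y, f x = Some y & Y y &
      forall x x', D x -> D x' -> f x = f x' -> x = x'].
have [| |D [f [[DX fY fI] _ Dmax]]] :=
    @maximal_partial_map _ _ P set0 (fun=> None).
- by split.
- move=> D f Pdir; split.
  + by move=> x Dx; have [D' [f' [[D'X _ _] _ /D'X]]] := Pdir _ _ Dx Dx.
  + move=> x Dx; have [D' [f' [[_ f'Y _] _ D'x _ ff']]] := Pdir _ _ Dx Dx.
    by rewrite ff'//; exact: f'Y.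
  + move=> x x' Dx Dx'.
    have [D' [f' [[_ _ f'I] _ D'x D'x' ff']]] := Pdir _ _ Dx Dx'.
    by rewrite !ff'//; exact: f'I.
have [XD|nXD] := pselect (X `<=` D).
  by left; exists f; split => [x /XD /fY //|x x' /XD ? /XD]; exact: fI.
right; have [x0 [Xx0 nDx0]] : exists x, X x /\ ~ D x.
  by apply: contrapT => h; apply: nXD => x Xx; apply: contrapT => nDx; apply: h; exists x.
have Ysurj y : Y y -> exists2 x, D x & f x = Some y.
  move=> Yy; apply: contrapT => nfy.
  (* A value [y] not yet taken could be given to [x0], against maximality. *)
  pose f' x := if pselect (x = x0) then Some y else f x.
  have f'D x : D x -> f' x = f x.
    by move=> Dx; rewrite /f'; case: pselect => // xx0; rewrite xx0 in Dx.
  have f'0 : f' x0 = Some y by rewrite /f'; case: pselect.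
  apply: nDx0; apply: (Dmax (D `|` [set x0]) f'); [|by left|exact: f'D|by right].
  split.
  + by move=> x [/DX//|->].
  + by move=> x [Dx|->]; [rewrite f'D//; exact: fY|exists y].
  + move=> x x' [Dx|->] [Dx'|->]//; rewrite ?f'0.
    * by rewrite !f'D//; exact: fI.
    * by rewrite f'D// => fx; exfalso; apply: nfy; exists x.
    * by rewrite f'D// => fx; exfalso; apply: nfy; exists x'.
have gP y : exists x, Y y -> D x /\ f x = Some y.
  have [Yy|nYy] := pselect (Y y); last by exists x0.
  by have [x Dx fx] := Ysurj _ Yy; exists x.
have [g {}gP] := choice gP.
exists (Some \o g); split=> [y Yy|y y' Yy Yy' [gyy']].
  by exists (g y) => //; apply: DX; exact: (gP y Yy).1.
have [_] := gP y Yy; have [_] := gP y' Yy'.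
by rewrite gyy' => -> [].
Qed.

Lemma infinite_nat_inj (K : Type) : infinite_set [set: K] ->
  exists i : nat -> K, injective i.
Proof.
move=> /infiniteP /card_leP[f].
exists (fun n => val (f (SigSub (mem_set (I : setT n))))) => m n /val_inj.
by move=> /inj; rewrite !in_setT => /(_ isT isT)[].
Qed.

(** Take a maximal injection of a square [A * A] into [A], where [D] stands for the square and [A D]
    reads [A] off its diagonal. If the complement of [A] embeds in [A], then [K] embeds in [A] and
    the injection transfers; otherwise the injection could be enlarged. *)
Lemma infinite_card_square (K : Type) : infinite_set [set: K] ->
  exists f : K * K -> K, injective f.
Proof.
move=> /infinite_nat_inj[i iI].
pose A (D : set (K * K)) := [set x | D (x, x)].
pose P (D : set (K * K)) (f : K * K -> K) :=
  [/\ forall x y, D (x, y) <-> A D x /\ A D y,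
      forall u, D u -> A D (f u) &
      forall u v, D u -> D v -> f u = f v -> u = v].
(* Starting from the square of a countable set keeps [A] infinite, so that [i 0], [i 1], [i 2] are
   available in [A] as distinct tags. *)
pose D0 : set (K * K) := [set u | range i u.1 /\ range i u.2].
have [i' i'K] : exists i' : K -> nat, forall n, i' (i n) = n.
  have h x : exists n, (range i x -> i n = x).
    by have [[n _ <-]|nx] := pselect (range i x); [exists n|exists 0%N].
  by have [i' i'P] := choice h; exists i' => n; apply: iI; apply: i'P; exists n.
have [| |D [f [[Dsq fA fI] D0D Dmax]]] :=
    @maximal_partial_map _ _ P D0 (fun u => i (pickle (i' u.1, i' u.2))).
- split.
  + by move=> x y; rewrite /A /D0 /=; split=> [[? ?]|[[? ?] [? ?]]].
  + by move=> u _; split; exists (pickle (i' u.1, i' u.2)).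
  + move=> [x y] [z t] [/= [m _ <-] [n _ <-]] [/= [p _ <-] [q _ <-]] /iI.
    by rewrite !i'K => /(pcan_inj pickleK)[-> ->].
- move=> D f Pdir; split.
  + move=> x y; split=> [Dxy|[Dx Dy]].
      have [D' [f' [[D'sq _ _] D'D D'xy _ _]]] := Pdir _ _ Dxy Dxy.
      by have [/D'D ? /D'D] := (D'sq _ _).1 D'xy.
    have [D' [f' [[D'sq _ _] D'D D'x D'y _]]] := Pdir _ _ Dx Dy.
    by apply: D'D; apply/D'sq.
  + move=> u Du; have [D' [f' [[_ f'A _] D'D D'u _ ff']]] := Pdir _ _ Du Du.
    by rewrite ff'//; apply: D'D; exact: f'A.
  + move=> u v Du Dv.
    have [D' [f' [[_ _ f'I] _ D'u D'v ff']]] := Pdir _ _ Du Dv.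
    by rewrite !ff'//; exact: f'I.
have AD x y : A D x -> A D y -> D (x, y) by move=> ? ?; apply/Dsq.
have Ai n : A D (i n) by apply: D0D; split; exists n.
have fAA x y : A D x -> A D y -> A D (f (x, y)) by move=> ? ?; apply: fA; exact: AD.
have fII x y z t : A D x -> A D y -> A D z -> A D t ->
    f (x, y) = f (z, t) -> x = z /\ y = t.
  move=> Ax Ay Az At fe.
  by have [-> ->] := fI _ _ (AD _ _ Ax Ay) (AD _ _ Az At) fe.
have [[j [jA jI]]|[j [jA jI]]] := set_inj_total (A D) (~` A D); last first.
(* the complement embeds into A, so that K embeds into two copies of A *)
  have [j' j'P] : exists j' : K -> K,
      forall x, ~ A D x -> j x = Some (j' x) /\ A D (j' x).
    have h x : exists y, ~ A D x -> j x = Some y /\ A D y.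
      by have [Ax|/jA[y ? ?]] := pselect (A D x); [exists x|exists y].
    by have [j' ?] := choice h; exists j'.
  pose h x := if pselect (A D x) then f (i 0%N, x) else f (i 1%N, j' x).
  have hA x : A D (h x).
    by rewrite /h; case: pselect => [/= ?|/= /j'P[]*]; exact: fAA.
  have hI x y : h x = h y -> x = y.
    rewrite /h; case: pselect => [Ax|nAx]; case: pselect => [Ay|nAy] /=.
    + by move=> /fII[]//.
    + have [_ ?] := j'P _ nAy.
      by move=> /fII[]// /iI.
    + have [_ ?] := j'P _ nAx.
      by move=> /fII[]// /iI.
    + have [jx ?] := j'P _ nAx; have [jy ?] := j'P _ nAy.
      by move=> /fII[]// _ jxy; apply: jI => //; rewrite jx jy jxy.
  exists (fun u => f (h u.1, h u.2)) => -[x y] [z t] /= /fII[]// /hI-> /hI->//.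
(* otherwise a disjoint copy B of A lets the injection extend to A `|` B *)
exfalso.
have [k kP] : exists k : K -> K, forall x, A D x -> j x = Some (k x) /\ ~ A D (k x).
  have h x : exists y, A D x -> j x = Some y /\ ~ A D y.
    by have [/jA[y ? ?]|nAx] := pselect (A D x); [exists y|exists x].
  by have [k ?] := choice h; exists k.
have kI x y : A D x -> A D y -> k x = k y -> x = y.
  move=> Ax Ay kxy; apply: jI => //.
  by rewrite (kP _ Ax).1 (kP _ Ay).1 kxy.
pose B := k @` A D.
have [k' k'P] : exists k' : K -> K, forall x, B x -> A D (k' x) /\ k (k' x) = x.
  have h x : exists y, B x -> A D y /\ k y = x.
    by have [[y Ay <-]|nBx] := pselect (B x); [exists y|exists x].
  by have [k' ?] := choice h; exists k'.
pose A' := A D `|` B.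
(* The new part of the square of [A'] has three blocks, A x B, B x A and B x B. [tag] names the
   block, [bar] brings both coordinates back to [A], and [k] moves the resulting code into [B], away
   from the values of [f]. *)
pose bar x := if pselect (A D x) then x else k' x.
pose tag x y := if pselect (A D x) then i 0%N else
                if pselect (A D y) then i 1%N else i 2%N.
pose D' : set (K * K) := [set u | A' u.1 /\ A' u.2].
pose f' u := if pselect (D u) then f u else k (f (tag u.1 u.2, f (bar u.1, bar u.2))).
have Abar x : A' x -> A D (bar x).
  rewrite /bar; case: pselect => //= nAx [//|Bx].
  by have [] := k'P x Bx.
have Atag x y : A D (tag x y).
  by rewrite /tag; case: pselect => //= _; case: pselect => /=.
have Acode x y : A' x -> A' y -> A D (f (tag x y, f (bar x, bar y))).
  by move=> /Abar ? /Abar ?; apply: (fAA) => //; exact: fAA.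
have barI x y : A' x -> A' y -> (A D x <-> A D y) -> bar x = bar y -> x = y.
  rewrite /bar; case: pselect => [Ax|nAx]; case: pselect => [Ay|nAy] //=.
  - by move=> _ _ [/(_ Ax)].
  - by move=> _ _ [_ /(_ Ay)].
  - by move=> [//|Bx] [//|By] _ e; rewrite -(k'P x Bx).2 -(k'P y By).2 e.
have DD' : D `<=` D' by move=> [x y] /Dsq[? ?]; split; left.
have PD' : P D' f'.
  split.
  - by move=> x y; rewrite /A /D' /=; split=> [[? ?]|[[? ?] [? ?]]].
  - move=> u Du; suff : A' (f' u) by split.
    rewrite /f'; case: pselect => [{}Du|nDu] /=; first by left; exact: fA.
    case: Du => ? ?; right.
    by exists (f (tag u.1 u.2, f (bar u.1, bar u.2))) => //; exact: Acode.
  - move=> [x y] [z t] [/= A'x A'y] [/= A'z A't]; rewrite /f'.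
    have Axy := Acode _ _ A'x A'y; have Azt := Acode _ _ A'z A't.
    case: pselect => [Du|nDu]; case: pselect => [Dv|nDv] /=.
    + exact: fI.
    + by move=> e; exfalso; apply: (kP _ Azt).2; rewrite -e; exact: fA.
    + by move=> e; exfalso; apply: (kP _ Axy).2; rewrite e; exact: fA.
    + move=> /(kI _ _ Axy Azt) /fII[]//; try by apply: (fAA) => //; exact: Abar.
      move=> etag /fII[]; try exact: Abar.
      move=> ebx eby; suff [Axz Ayt] : (A D x <-> A D z) /\ (A D y <-> A D t).
        by rewrite (barI _ _ A'x A'z Axz ebx) (barI _ _ A'y A't Ayt eby).
      move: etag nDu nDv; rewrite /tag.
      case: (pselect (A D x)) => Ax; case: (pselect (A D z)) => Az;
        case: (pselect (A D y)) => Ay; case: (pselect (A D t)) => At /=;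
        first [by move=> /iI | by move=> _ _ _; split |
          by move=> _ nxy nzt; exfalso;
             first [apply: nxy; exact: AD | apply: nzt; exact: AD]].
(* Maximality would put the point [k (i 0)] of [B] into [A]. *)
apply: (kP _ (Ai 0%N)).2.
apply: (Dmax D' f' PD' DD').
  by move=> u Du; rewrite /f'; case: pselect.
by split; right; exists (i 0%N).
Qed.

Lemma infinite_card_seq (K : Type) : infinite_set [set: K] ->
  exists f : nat * nat * seq K -> K, injective f.
Proof.
move=> Kinf; have [f fI] := infinite_card_square Kinf.
have [i iI] := infinite_nat_inj Kinf.
(* Lists are folded by the pairing [f]; the first component is [i 0] for the empty list and [i 1]
   for a cons, so lists of different lengths get different codes. *)
pose code := foldr (fun x y => f (i 1%N, f (x, y))) (f (i 0%N, i 0%N)).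
have codeI : injective code.
  elim=> [|x s IH] [|y t] //=; [by move=> /fI[/iI]|by move=> /fI[/iI]|].
  by move=> /fI[/fI[-> /IH->]].
exists (fun u => f (i (pickle u.1), code u.2)) => -[p s] [q t] /=.
by move=> /fI[/iI /(pcan_inj pickleK)-> /codeI->].
Qed.

(** All cardinality bounds for G^bullet come from here: it suffices to describe each member of a
    family by two numbers and a finite list over [K]. *)
Lemma card_le_range_nat_seq (K T : Type) (g : nat -> nat -> seq K -> T)
    (A : set T) : infinite_set [set: K] ->
  (forall t, A t -> exists m n s, t = g m n s) -> card_le A [set: K].
Proof.
move=> Kinf Ag; have [f fI] := infinite_card_seq Kinf.
apply: (@card_le_trans _ _ _ [set: nat * nat * seq K]); last first.
  have fI' : {in [set: nat * nat * seq K] &, injective f} by move=> u v _ _ /fI.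
  have /card_eqPle[_ h] := inj_card_eq fI'.
  by apply: card_le_trans h _; exact: card_leT.
apply: (@card_le_trans _ _ _ ((fun u : nat * nat * seq K => g u.1.1 u.1.2 u.2) @` setT)).
  by apply: subset_card_le => t /Ag[m [n [s ->]]]; exists (m, n, s).
exact: card_image_le.
Qed.

(** Indexing [A] by [K] lets lists over [K] code finite choices from [A]. Indices outside the image
    of the given injection are sent to a fixed point of [A]. *)
Lemma card_le_enum (K T : Type) (A : set T) : card_le A [set: K] -> A !=set0 ->
  exists2 phi : K -> T, (forall k, A (phi k)) & A `<=` range phi.
Proof.
move=> /card_leP[f] [t0 At0].
have h k : exists t, A t /\
    forall u (Au : A u), val (f (SigSub (mem_set Au))) = k -> u = t.
  have [[t [At <-]]|nk] :=
      pselect (exists t (At : A t), val (f (SigSub (mem_set At))) = k).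
    exists t; split=> // u Au /val_inj /inj.
    by rewrite !in_setT => /(_ isT isT)[].
  by exists t0; split=> // u Au fu; exfalso; apply: nk; exists u, Au.
have [phi phiP] := choice h.
exists phi => [k|t At]; first exact: (phiP k).1.
by exists (val (f (SigSub (mem_set At)))) => //; apply/esym/((phiP _).2 t At).
Qed.

(** * Gyrogroups *)

Section gyrogroup.
Variables (G : Type) (op : G -> G -> G) (e : G) (inv : G -> G).
Variable gyr : G -> G -> G -> G.
Hypothesis gyroG : is_gyrogroup op e inv gyr.

(** By G3, adding [inv a] on the left of [op a u] leaves gyr[inv a, a](u), and gyrations are
    injective. *)
Lemma gyro_op_inj a : injective (op a).
Proof.
move=> u v auv; case: gyroG => -[G1 _] [G2 _] G3 Gass _.
have := congr1 (op (inv a)) auv; rewrite !Gass (G2 a).1 !(G1 _).1.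
by have [/bij_inj gI _] := G3 (inv a) a; exact: gI.
Qed.

(** The loop property turns gyr[inv a, a] into gyr[e, a], which is the identity. *)
Lemma gyroKl a x : op (inv a) (op a x) = x.
Proof.
have [[G1 _] [G2 _] G3 Gass Gloop] := gyroG.
have gyr0 y z : gyr e y z = z.
  by apply: (@gyro_op_inj y); rewrite -{1}(G1 y).1 -Gass (G1 _).1.
by rewrite Gass (G2 a).1 (G1 _).1 -Gloop (G2 a).1 gyr0.
Qed.

Lemma gyroVKl a x : op a (op (inv a) x) = x.
Proof. by apply: (@gyro_op_inj (inv a)); rewrite gyroKl. Qed.

(* The left Bol identity: it is the loop property G4 rewritten with
   gyr[x,y] = L_{x+y}^-1 L_x L_y. *)
Lemma gyro_bol a b z : op (op b (op a b)) z = op b (op a (op b z)).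
Proof.
have [[G1 _] [G2 _] G3 Gass Gloop] := gyroG.
have gyrE x y w : gyr x y w = op (inv (op x y)) (op x (op y w)).
  by rewrite (Gass x y) gyroKl.
(* This is gyr[a,b](z), so [op (op a b) w] equals [op a (op b z)] and every term of the loop
   property for gyr[inv a, op a b] cancels. *)
pose w := op (inv (op a b)) (op a (op b z)).
have := gyrE (inv a) (op a b) w.
rewrite -Gloop gyroKl gyrE /w gyroVKl !gyroKl => zE.
by rewrite -[in LHS]zE gyroVKl.
Qed.

Lemma gyro_div a b : exists x, op x a = b.
Proof.
have [[G1 _] [G2 _] _ _ _] := gyroG.
(* By the Bol identity, adding [a] on the right of (-a) + (y + (-a)) gives (-a) + y; take y = a +
   b. *)
exists (op (inv a) (op (op a b) (inv a))).
by rewrite gyro_bol (G2 a).1 (G1 _).2 gyroKl.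
Qed.

End gyrogroup.

(** * Step functions *)

Section step_functions.
Local Open Scope ring_scope.
Variable R : realType.
Implicit Types (G H I : Type) (A : seq R) (r s : J R).

(* Constancy between the cut points listed in A, in any order; unlike the
   increasing partitions of is_step, cut lists can be concatenated. *)
Definition step_on A G (f : J R -> G) := forall r s,
  (forall a, a \in A -> (a <= sval r) = (a <= sval s)) -> f r = f s.

Lemma is_step_on G (f : J R -> G) : is_step f -> exists A, step_on A f.
Proof.
move=> [n [a [a0 an _ fa]]]; exists [seq a k | k <- iota 0 n.+1] => r s rs.
have aE k : (k <= n)%N -> (a k <= sval r) = (a k <= sval s).
  by move=> kn; apply: rs; apply: map_f; rewrite mem_iota.
have [k kn rk] : exists2 k, (k < n)%N & a k <= sval r < a k.+1.
  have : a 0%N <= sval r < a n by rewrite a0 an; exact: (svalP r).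
  elim: n {an fa rs aE} => [|n IH]; first by case/andP=> /le_lt_trans h /h; rewrite ltxx.
  have [rn /andP[r0 _]|nr /andP[_ rn]] := ltP (sval r) (a n).
    have [|k kn rk] := IH; first by rewrite r0.
    by exists k => //; exact: ltnW.
  by exists n => //; rewrite nr.
apply: (fa k kn) => //; rewrite -aE ?(ltnW kn)// ltNge -aE//.
by rewrite -ltNge.
Qed.

Lemma step_on_is_step A G (f : J R -> G) : step_on A f -> is_step f.
Proof.
move=> fA.
(* Cuts outside (0,1) separate no points of [0,1). The others, sorted without repetition and framed
   by 0 and 1, form the required partition. *)
pose B := sort <=%R (undup [seq a <- A | 0 < a < 1]).
have BE a : (a \in B) = (0 < a < 1) && (a \in A).
  by rewrite mem_sort mem_undup mem_filter.
pose S := 0 :: rcons B 1.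
have sS : sorted <%R S.
  rewrite lt_sorted_pairwise /= all_rcons ltr01 pairwise_rcons /=.
  rewrite -lt_sorted_pairwise sort_lt_sorted undup_uniq andbT.
  by apply/andP; split; apply/allP => x; rewrite BE => /andP[/andP[]].
have szS : size S = (size B).+2 by rewrite /= size_rcons.
have mono i j : (i < (size B).+2)%N -> (j < (size B).+2)%N ->
    (nth 1 S i < nth 1 S j) = (i < j)%N.
  by move=> hi hj; apply: lt_sorted_ltn_nth => //; rewrite inE szS.
exists (size B).+1, (nth 1 S); split => //.
- by rewrite /= nth_rcons ltnn eqxx.
- by move=> k kn; rewrite mono// ltnS ltnW.
- move=> k kn r s /andP[kr rk] /andP[ks sk]; apply: fA => a aA.
  have [/andP[r0 r1] /andP[s0 s1]] := (svalP r, svalP s).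
  have [a0|a0] := leP a 0; first by rewrite !(le_trans a0).
  have [a1|a1] := leP 1 a.
    by rewrite !leNgt (lt_le_trans r1 a1) (lt_le_trans s1 a1).
  have /(nthP 1)[j jS <-] : a \in S.
    by rewrite inE mem_rcons inE BE a0 a1 aA !orbT.
  rewrite szS in jS.
  have [jk|kj] := leqP j k.
    have jlek : nth 1 S j <= nth 1 S k.
      by rewrite leNgt mono// ?ltnS ?(ltnW kn)// -leqNgt.
    by rewrite !(le_trans jlek).
  have klej : nth 1 S k.+1 <= nth 1 S j.
    by rewrite leNgt mono// -leqNgt.
  by rewrite !leNgt (lt_le_trans rk klej) (lt_le_trans sk klej).
Qed.

Lemma is_step_cst G (x : G) : is_step (fun _ : J R => x).
Proof. exact: (@step_on_is_step [::]). Qed.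

(** Concatenated cut lists serve both functions. With [I] equal to [Prop], this also shows that a
    set defined by a relation between two step functions is a step set, hence measurable below. *)
Lemma is_step2 G H I (F : G -> H -> I) (f : J R -> G) (g : J R -> H) :
  is_step f -> is_step g -> is_step (fun r => F (f r) (g r)).
Proof.
move=> /is_step_on[A fA] /is_step_on[B gB]; apply: (@step_on_is_step (A ++ B)).
move=> r s rs; congr F; [apply: fA|apply: gB] => a aA; apply: rs;
  by rewrite mem_cat aA ?orbT.
Qed.

Lemma is_step1 G H (F : G -> H) (f : J R -> G) :
  is_step f -> is_step (fun r => F (f r)).
Proof. by move=> sf; exact: (@is_step2 _ _ _ (fun x _ => F x) f f). Qed.

Lemma is_step_finite_range G (f : J R -> G) : is_step f -> finite_set (range f).
Proof.
move=> /is_step_on[A fA].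
(* The claim is stated for every subset [X], so that induction can remove a cut [a] by splitting [X]
   at [a]. *)
suff : forall X : set (J R), (forall r s, X r -> X s ->
    (forall a, a \in A -> (a <= sval r) = (a <= sval s)) -> f r = f s) ->
    finite_set (f @` X).
  by apply => r s _ _; exact: fA.
elim: A {fA} => [|a A IH] X fX.
  have [[r Xr]|X0] := pselect (X !=set0); last first.
    apply: (@sub_finite_set _ _ set0); last exact: finite_set0.
    by move=> y [r Xr _]; apply: X0; exists r.
  apply: (@sub_finite_set _ _ [set f r]); last exact: finite_set1.
  by move=> y [s Xs <-] /=; exact: fX.
apply: (@sub_finite_set _ _ (f @` (X `&` [set r | a <= sval r]) `|`
                             f @` (X `&` [set r | ~~ (a <= sval r)]))).
  move=> _ [r Xr <-]; case: (boolP (a <= sval r)) => ar; [left|right];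
    by exists r.
rewrite finite_setU; split; apply: IH => r s [Xr /= ar] [Xs /= as_] rs;
  apply: fX => // b; rewrite inE => /predU1P[->|]; [|exact: rs| |exact: rs].
  by rewrite ar as_.
by rewrite (negbTE ar) (negbTE as_).
Qed.

(** * Lebesgue measure of step sets *)

Definition muJ (B : set (J R)) : \bar R := lebesgue_measure (sval @` B).

Lemma measurable_is_step (B : set (J R)) :
  is_step B -> measurable (sval @` B : set (measurableTypeR R)).
Proof.
move=> /is_step_on[A BA].
have -> : sval @` B = `[0, 1[%classic `&`
    [set x | exists h : 0 <= x < 1, B (exist _ x h)].
  apply/seteqP; split=> [_ [[x h] Bx <-]|x [_ [h Bh]]].
    by split; [rewrite /= in_itv|exists h].
  by exists (exist _ x h).
set Q := (X in _ `&` X).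
(* Induction on the cuts splits [X] by half-lines; once no cut is left, [X] intersected with [Q] is
   empty or all of [X]. *)
suff : forall X : set R, measurable (X : set (measurableTypeR R)) ->
    (forall x y, X x -> X y -> (forall a, a \in A -> (a <= x) = (a <= y)) ->
       Q x -> Q y) ->
    measurable (X `&` Q : set (measurableTypeR R)).
  apply; first exact: measurable_itv.
  move=> x y _ /=; rewrite in_itv /= => hy xy [hx Bx].
  by exists hy; rewrite -(BA (exist _ x hx)).
elim: A {BA} => [|a A IH] X mX XQ.
  have [[x [Xx Qx]]|nXQ] := pselect ((X `&` Q) !=set0); last first.
    have -> : X `&` Q = set0 by rewrite -subset0 => x ?; apply: nXQ; exists x.
    exact: measurable0.
  have -> : X `&` Q = X; last by [].
  by apply/seteqP; split=> [y []//|y Xy]; split=> //; exact: (XQ x).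
have -> : X `&` Q = ((X `&` `[a, +oo[%classic) `&` Q) `|`
                   ((X `&` `]-oo, a[%classic) `&` Q).
  apply/seteqP; split=> [x [Xx Qx]|x [[[]]|[[]]]//].
  by have [ax|xa] := leP a x; [left|right]; split=> //; split=> //=;
    rewrite in_itv/= ?ax ?xa.
apply: measurableU; apply: IH.
- by apply: measurableI => //; exact: measurable_itv.
- move=> x y [Xx /=]; rewrite in_itv /= andbT => ax [Xy];
    rewrite /= in_itv /= andbT => ay xy.
  by apply: XQ => // b; rewrite inE => /predU1P[->|]; [rewrite ax ay|exact: xy].
- by apply: measurableI => //; exact: measurable_itv.
- move=> x y [Xx /=]; rewrite in_itv /= => xa [Xy]; rewrite /= in_itv /= => ya xy.
  apply: XQ => // b; rewrite inE => /predU1P[->|]; last exact: xy.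
  by rewrite !leNgt xa ya.
Qed.

Lemma muJ_le (B C : set (J R)) : is_step B -> is_step C -> B `<=` C ->
  (muJ B <= muJ C)%E.
Proof.
move=> sB sC BC; apply: le_measure; rewrite ?inE; try exact: measurable_is_step.
exact: image_subset.
Qed.

Lemma muJ_set0 : muJ (set0 : set (J R)) = 0%E.
Proof. by rewrite /muJ image_set0 measure0. Qed.

Lemma muJ_setT : muJ setT = 1%E.
Proof.
rewrite /muJ (_ : sval @` setT = `[0, 1[%classic :> set R).
  by rewrite lebesgue_measure_itv /= lte_fin ltr01 oppr0 adde0.
apply/seteqP; split=> [_ [r _ <-]|x]; rewrite /= in_itv /=; first exact: (svalP r).
by move=> h; exists (exist _ x h).
Qed.

Lemma muJ_fin (B : set (J R)) : is_step B -> muJ B \is a fin_num.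
Proof.
move=> sB; rewrite ge0_fin_numE ?measure_ge0//.
have /le_lt_trans : (muJ B <= muJ setT)%E.
  by apply: muJ_le => //; exact: is_step_cst.
by apply; rewrite muJ_setT ltry.
Qed.

Lemma muJ_cover (B C D : set (J R)) (a b : R) :
  is_step B -> is_step C -> is_step D -> B `<=` C `|` D ->
  (muJ C < a%:E)%E -> (muJ D <= b%:E)%E -> (muJ B < (a + b)%:E)%E.
Proof.
move=> sB sC sD BCD Ca Db.
have sCD : is_step (C `|` D) by exact: is_step2.
apply: (le_lt_trans (muJ_le sB sCD BCD)).
rewrite /muJ image_setU EFinD; apply: le_lt_trans (lte_leD _ Ca Db).
  by apply: measureU2; exact: measurable_is_step.
exact: muJ_fin.
Qed.

Lemma muJ_cover_le (B C D : set (J R)) (a b : R) :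
  is_step B -> is_step C -> is_step D -> B `<=` C `|` D ->
  (muJ C <= a%:E)%E -> (muJ D <= b%:E)%E -> (muJ B <= (a + b)%:E)%E.
Proof.
move=> sB sC sD BCD Ca Db.
have sCD : is_step (C `|` D) by exact: is_step2.
apply: (le_trans (muJ_le sB sCD BCD)).
rewrite /muJ image_setU EFinD; apply: le_trans (leeD Ca Db).
by apply: measureU2; exact: measurable_is_step.
Qed.

(** A step set containing [r0] contains an interval [r0, r0 + d), which stops before the next cut
    and before 1. *)
Lemma muJ_pos (B : set (J R)) r0 : is_step B -> B r0 ->
  exists2 d : R, 0 < d & (d%:E <= muJ B)%E.
Proof.
move=> sB Br0; have [A BA] := is_step_on sB.
have /andP[r00 r01] := svalP r0.
have [d d0 [dr dA]] : exists2 d, 0 < d & sval r0 + d <= 1 /\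
    forall a x, a \in A -> sval r0 <= x < sval r0 + d -> (a <= sval r0) = (a <= x).
  elim: A {BA} => [|a A [d d0 [dr dA]]].
    by exists (1 - sval r0); [rewrite subr_gt0|split=> //; rewrite addrC subrK].
  have [ar|ra] := leP a (sval r0).
    exists d => //; split=> // b x; rewrite inE => /predU1P[->|]; last exact: dA.
    by move=> /andP[rx _]; rewrite ar (le_trans ar rx).
  exists (Num.min d (a - sval r0)); first by rewrite lt_min d0 subr_gt0.
  split; first by apply: le_trans dr; rewrite lerD2l ge_min lexx.
  move=> b x; rewrite inE => /predU1P[->|bA] /andP[rx];
      rewrite -ltrBlDl lt_min => /andP[xd xa].
    by apply/idP/idP; [rewrite leNgt ra|rewrite leNgt -(ltrD2r (- sval r0)) xa].
  by apply: dA => //; rewrite rx -ltrBlDl.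
exists d => //.
have -> : d%:E = lebesgue_measure (`[sval r0, sval r0 + d[%classic : set R).
  by rewrite lebesgue_measure_itv /= lte_fin ltrDl d0 -EFinB addrAC subrr add0r.
apply: le_measure; rewrite ?inE; [exact: measurable_itv|exact: measurable_is_step|].
move=> x /=; rewrite in_itv /= => xI.
have hx : 0 <= x < 1.
  by case/andP: xI => rx xr; rewrite (le_trans r00 rx) (lt_le_trans xr dr).
exists (exist _ x hx) => //.
by rewrite -(BA r0) => // a aA; exact: dA.
Qed.

(** * Approximation on the grid of mesh 1/(n+1) *)

Definition cell n r : nat := Num.truncn (n.+1%:R * sval r).

Lemma J0_subproof : ((0 : R) <= (0 : R) < (1 : R))%R.
Proof. by rewrite lexx ltr01. Qed.

(** The left end of cell [k]; the default point 0 is taken only when [k] exceeds [n]. *)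
Definition gridpt n (k : nat) : J R :=
  insubd (exist _ 0 J0_subproof : J R) (k%:R / n.+1%:R).

Lemma cellP n r : (cell n r)%:R / n.+1%:R <= sval r < (cell n r).+1%:R / n.+1%:R.
Proof.
have /andP[r0 r1] := svalP r.
rewrite ler_pdivrMr ?ltr0n// ltr_pdivlMr ?ltr0n// ![sval r * _]mulrC.
by apply: truncn_itv; rewrite mulr_ge0.
Qed.

Lemma cell_lt n r : (cell n r < n.+1)%N.
Proof.
have /andP[_ r1] := svalP r; have /andP[cr _] := cellP n r.
move: (le_lt_trans cr r1); rewrite ltr_pdivrMr ?ltr0n// mul1r.
by rewrite ltr_nat.
Qed.

Lemma gridptE n k : (k < n.+1)%N -> sval (gridpt n k) = k%:R / n.+1%:R.
Proof.
move=> kn; apply: insubdK; rewrite unfold_in divr_ge0//=.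
by rewrite ltr_pdivrMr ?ltr0n// mul1r ltr_nat.
Qed.

Lemma is_step_cell n G (h : nat -> G) : is_step (fun r => h (cell n r)).
Proof.
apply: (@is_step1 _ _ h).
apply: (@step_on_is_step [seq k%:R / n.+1%:R | k <- iota 0 n.+1]).
suff H r s : (forall a, a \in [seq k%:R / n.+1%:R | k <- iota 0 n.+1] ->
    (a <= sval r) = (a <= sval s)) -> ~ (cell n r < cell n s)%N.
  move=> r s rs; apply/eqP; rewrite eqn_leq; apply/andP; split;
    rewrite leqNgt; apply/negP.
    by apply: H => a aA; apply/esym/rs.
  exact: H.
move=> rs cells.
have : (cell n s)%:R / n.+1%:R <= sval r.
  rewrite rs; first by case/andP: (cellP n s).
  by apply/mapP; exists (cell n s); rewrite // mem_iota; exact: cell_lt.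
apply/negP; rewrite -ltNge; case/andP: (cellP n r) => _ /lt_le_trans; apply.
by rewrite ler_pM2r ?invr_gt0 ?ltr0n// ler_nat.
Qed.

(** If [f r] differs from the value at the left end of its cell, some cut [a] lies after that left
    end and at or before [r], so [r] is in [a, a + 1/(n+1)). These intervals have total length at
    most (number of cuts)/(n+1). *)
Lemma step_grid_approx G (f : J R -> G) (d : R) : is_step f -> 0 < d ->
  exists n, (muJ [set r | f r <> f (gridpt n (cell n r))] < d%:E)%E.
Proof.
move=> sf d0; have [A fA] := is_step_on sf.
have [n nd] : exists n : nat, (size A)%:R / n.+1%:R < d.
  exists (Num.truncn ((size A)%:R / d)).
  rewrite ltr_pdivrMr ?ltr0n// mulrC -ltr_pdivrMr//.
  by have /andP[] := truncn_itv (divr_ge0 (ler0n R (size A)) (ltW d0)).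
exists n; set B := [set r | _].
have sB : is_step B.
  apply: (@is_step2 _ _ _ (fun x y => x <> y)) => //.
  exact: (is_step_cell n (fun k => f (gridpt n k))).
pose U (A : seq R) : set R := \big[setU/set0]_(a <- A) `[a, a + n.+1%:R^-1[%classic.
have mU A' : measurable (U A' : set (measurableTypeR R)).
  by apply: bigsetU_measurable => a _; exact: measurable_itv.
have BU : sval @` B `<=` U A.
  move=> _ [r Br <-]; apply: contrapT => nUr; apply: Br.
  apply: fA => a aA; rewrite gridptE ?cell_lt//.
  have /andP[cr rc] := cellP n r.
  apply/idP/idP => [ar|/le_trans]; last exact.
  rewrite leNgt; apply/negP => ca; apply: nUr.
  rewrite /U -bigcup_seq; exists a => //=; rewrite in_itv /= ar /=.
  apply: lt_trans rc _.
  by rewrite -natr1 mulrDl mul1r ltrD2r.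
apply: (@le_lt_trans _ _ (lebesgue_measure (U A))).
  apply: le_measure => //; rewrite inE//; exact: measurable_is_step.
apply: (@le_lt_trans _ _ ((size A)%:R / n.+1%:R)%:E); last by rewrite lte_fin.
elim: A {sf fA nd BU} => [|a A IH] /=.
  by rewrite /U big_nil measure0 mul0r.
rewrite {1}/U big_cons -/(U A).
apply: (@le_trans _ _ (lebesgue_measure
    (`[a, (a + n.+1%:R^-1)%R[%classic : set R) + lebesgue_measure (U A))%E).
  by apply: measureU2 => //; exact: measurable_itv.
rewrite -[(size A).+1%:R]natr1 addrC mulrDl mul1r EFinD; apply: leeD => //.
rewrite lebesgue_measure_itv /= lte_fin ltrDl invr_gt0 ltr0n /=.
by rewrite -EFinB addrAC subrr add0r.
Qed.

(** Common core of the network, density and narrowness proofs: a [t] related to the value at each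
    grid point is also related to [f r] wherever [f r] equals that value. *)
Lemma step_cell_choice (G T : Type) (t0 : T) (f : J R -> G) (rel : G -> T -> Prop)
    (eps : R) : is_step f -> 0 < eps -> (forall x, exists t, rel x t) ->
  exists n (s : seq T), (muJ [set r | ~ rel (f r) (nth t0 s (cell n r))] < eps%:E)%E.
Proof.
move=> sf eps0 /choice[c cP]; have [n ndf] := step_grid_approx sf eps0.
exists n, (mkseq (fun k => c (f (gridpt n k))) n.+1).
apply: le_lt_trans ndf; apply: muJ_le.
- exact: (@is_step2 _ _ _ (fun x t => ~ rel x t) f _ sf
    (is_step_cell n (nth t0 (mkseq (fun k => c (f (gridpt n k))) n.+1)))).
- exact: (@is_step2 _ _ _ (fun x y => x <> y) f _ sf
    (is_step_cell n (fun k => f (gridpt n k)))).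
- move=> r /= nrel fr; apply: nrel; rewrite nth_mkseq ?cell_lt// {1}fr.
  exact: cP.
Qed.

End step_functions.

(** * The topology of G^bullet *)

Section topological_gyrogroup.
Local Open Scope ring_scope.
Variables (R : realType) (G : topologicalType) (op : G -> G -> G).
Variables (e : G) (inv : G -> G) (gyr : G -> G -> G -> G).
Hypothesis topG : is_topological_gyrogroup op e inv gyr.

Let gyroG : is_gyrogroup op e inv gyr. Proof. by case: topG. Qed.

Let gyro_op_inv_e x : op (inv e) x = x.
Proof.
by have [[G1 _] _ _ _ _] := gyroG; rewrite -{1}(G1 x).1 (gyroKl gyroG).
Qed.

Lemma open_preimage_op x (U : set G) : open U -> open (op x @^-1` U).
Proof.
have [_ opC _ _] := topG.
apply: open_comp => y _.
by apply: (continuous_comp (f := fun z => (x, z)) (g := fun p : G * G => op p.1 p.2));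
  [apply: cvg_pair; [exact: cvg_cst|exact: cvg_id]|exact: opC].
Qed.

(** By left cancellation, [g] lies in f + O(V, eps) exactly when (-f) + g lies in O(V, eps), so
    membership is tested on [g] itself. *)
Lemma open_bul_nbhd (U : set (J R -> G)) f : open_bul R op e U -> U f ->
  exists V (eps : R), [/\ open V, V e, 0 < eps &
    forall g, is_step g ->
      (muJ [set r | ~ V (op (inv (f r)) (g r))] < eps%:E)%E -> U g].
Proof.
move=> [UG Uop] Uf; have [V [eps [oV Ve eps0] VU]] := Uop _ Uf.
exists V, eps; split => // g sg gV; apply: VU.
exists (fun r => op (inv (f r)) (g r)).
  split=> //; apply: (@is_step2 _ _ _ _ (fun x y => op (inv x) y)) => //.
  exact: UG.
by apply/funext => r; rewrite /opbul (gyroVKl gyroG).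
Qed.

Lemma finite_common_nbhd (X : set G) (F : G -> set G) : finite_set X ->
  (forall x, open (F x) /\ F x e) ->
  exists V, [/\ open V, V e & forall x, X x -> V `<=` F x].
Proof.
move=> /finite_seqP[s ->] Fx.
elim: s => [|x s [V [oV Ve VF]]].
  by exists setT; split => //; exact: openT.
have [oF Fe] := Fx x.
exists (V `&` F x); split => //; first exact: openI.
by move=> y /=; rewrite inE => /predU1P[->|ys] v [Vv Fv] //; exact: VF Vv.
Qed.

(** Openness at [f] uses the slack between [eps] and the measure [m] of the set where [f] leaves
    [V]: a perturbation may leave [V'] on a set of measure less than [eps - m]. *)
Lemma open_Obul (V : set G) (eps : R) : open V -> V e -> 0 < eps ->
  open_bul R op e (Obul R V eps).
Proof.
move=> oV Ve eps0; have [[G1 _] _ _ _ _] := gyroG.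
split=> [f []//|f [sf fV]].
(* The premise [V x] makes the condition vacuous at values outside [V], whose points are already
   counted in [m]. *)
have [V' [oV' V'e V'V]] : exists V', [/\ open V', V' e &
    forall x, range f x -> V' `<=` [set v | V x -> V (op x v)]].
  apply: finite_common_nbhd (is_step_finite_range sf) _ => x.
  have [Vx|nVx] := pselect (V x); last first.
    suff -> : [set v | V x -> V (op x v)] = setT by split; [exact: openT|].
    by apply/seteqP; split=> v //= _ /nVx.
  suff -> : [set v | V x -> V (op x v)] = op x @^-1` V.
    by split; [exact: open_preimage_op|rewrite /preimage /= (G1 x).2].
  by apply/seteqP; split=> v /=; [exact|].
have sfV : is_step [set r | ~ V (f r)] by exact: (is_step1 (fun x => ~ V x)).
have mE : muJ [set r | ~ V (f r)] = (fine (muJ [set r | ~ V (f r)]))%:E.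
  by rewrite fineK// muJ_fin.
set m := fine _ in mE.
have meps : m < eps by move: fV; rewrite -/(muJ _) mE lte_fin.
exists V', (eps - m); first by split => //; rewrite subr_gt0.
move=> _ [h [sh hV'] <-].
have sfh : is_step (opbul op f h) by exact: is_step2.
split => //; rewrite -(subrK m eps).
apply: (@muJ_cover _ _ [set r | ~ V' (h r)] [set r | ~ V (f r)]) => //.
- exact: (is_step1 (fun x => ~ V x)).
- exact: (is_step1 (fun x => ~ V' x)).
- move=> r /= nV; have [V'h|?] := pselect (V' (h r)); last by left.
  right=> Vf; apply: nV; apply: (V'V (f r)) => //; by exists r.
- by rewrite mE.
Qed.

(** * Local bases, networks, dense subsets and narrowness *)

Section cardinality.
Variable K : Type.
Hypothesis Kinf : infinite_set [set: K].

Let pos_inv_nat (eps : R) : 0 < eps -> exists m : nat, m.+1%:R^-1 < eps.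
Proof.
move=> eps0; exists (Num.truncn eps^-1).
rewrite invf_plt ?posrE ?ltr0n//.
by have /andP[] := truncn_itv (ltW (etrans (invr_gt0 _) eps0)).
Qed.

Lemma local_base_bul : local_base_card_le K open e ->
  local_base_card_le K (open_bul R op e) (const_bul R e).
Proof.
move=> [B [[Bop Bbase] BK]].
have [phi phiB Bphi] : exists2 phi : K -> set G, forall k, B (phi k) & B `<=` range phi.
  by apply: card_le_enum => //; have [W BW _] := Bbase _ openT I; exists W.
exists [set W | exists k m, W = Obul R (phi k) m.+1%:R^-1]; split; last first.
  have [k0 _] := infinite_setN0 Kinf.
  apply: (card_le_range_nat_seq
    (g := fun m _ s => Obul R (phi (head k0 s)) m.+1%:R^-1)) => //.
  by move=> _ [k [m ->]]; exists m, 0%N, [:: k].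
split=> [_ [k [m ->]]|U Uop Ue].
  have [oV Ve] := Bop _ (phiB k).
  split; first by apply: open_Obul; rewrite // invr_gt0 ltr0n.
  split; first exact: is_step_cst.
  rewrite -/(muJ _) (_ : mkset _ = set0).
    by rewrite muJ_set0 lte_fin invr_gt0 ltr0n.
  by rewrite -subset0 => r.
have [V [eps [oV Ve eps0 VU]]] := open_bul_nbhd Uop Ue.
have [W BW WV] := Bbase V oV Ve; have [k _ kW] := Bphi _ BW.
have [m meps] := pos_inv_nat eps0.
exists (Obul R (phi k) m.+1%:R^-1); first by exists k, m.
move=> g [sg gW]; apply: VU => //.
apply: (@le_lt_trans _ _ (m.+1%:R^-1)%:E); last by rewrite lte_fin.
apply: ltW; apply: le_lt_trans gW; apply: muJ_le.
- exact: (is_step1 (fun x => ~ V (op (inv e) x))).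
- exact: (is_step1 (fun x => ~ phi k x)).
- move=> r /= nV; rewrite kW => Wg; apply: nV.
  by rewrite gyro_op_inv_e; exact: WV.
Qed.

(** A network member prescribes one member of the network of G on each grid cell, up to a set of
    measure below 1/(m+1). *)
Lemma network_bul : network_card_le K (@open G) -> network_card_le K (open_bul R op e).
Proof.
move=> [P [Pnet PK]]; have [_ [G2 _] _ _ _] := gyroG.
have [phi phiP Pphi] : exists2 phi : K -> set G, forall k, P (phi k) & P `<=` range phi.
  by apply: card_le_enum => //; have [W PW _] := Pnet e _ openT I; exists W.
have [k0 _] := infinite_setN0 Kinf.
pose N n m s : set (J R -> G) := [set g | is_step g /\
  (muJ [set r | ~ phi (nth k0 s (cell n r)) (g r)] < (m.+1%:R^-1)%:E)%E].
exists [set W | exists n m s, W = N n m s]; split; last first.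
  by apply: (card_le_range_nat_seq (g := N)) => // _ [n [m [s ->]]]; exists n, m, s.
move=> f U Uop Uf; have sf : is_step f by exact: Uop.1.
have [V [eps [oV Ve eps0 VU]]] := open_bul_nbhd Uop Uf.
have [m meps] : exists m : nat, m.+1%:R^-1 < eps / 2.
  by apply: pos_inv_nat; rewrite divr_gt0.
have m0 : (0 : R) < m.+1%:R^-1 by rewrite invr_gt0 ltr0n.
(* The preimage is the translate x + V. Where [rel] holds and [g] obeys the prescription, g(r) lies
   in f(r) + V; the two exceptional sets have measure below eps/2 each. *)
pose rel x k := phi k x /\ phi k `<=` op (inv x) @^-1` V.
have [n [s fs]] := step_cell_choice k0 (rel := rel) sf m0 (fun x => ltac:(
  have [||W PW [Wx WV]] := Pnet x (op (inv x) @^-1` V);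
    [exact: open_preimage_op|by rewrite /preimage /= (G2 x).1|
     by have [k _ kW] := Pphi _ PW; exists k; rewrite /rel kW])).
have scell := is_step_cell R n (nth k0 s).
exists (N n m s); first by exists n, m, s.
split.
  split => //; apply: le_lt_trans fs; apply: muJ_le.
  - exact: (@is_step2 _ _ _ _ (fun k x => ~ phi k x)).
  - exact: (@is_step2 _ _ _ _ (fun x k => ~ rel x k)).
  - by move=> r /= nphi [].
move=> g [sg gs]; apply: VU => //.
apply: (@lt_trans _ _ (m.+1%:R^-1 + m.+1%:R^-1)%:E); last first.
  by rewrite lte_fin [ltRHS]splitr ltrD.
apply: (muJ_cover (C := [set r | ~ rel (f r) (nth k0 s (cell n r))])) fs (ltW gs).
- exact: (@is_step2 _ _ _ _ (fun x y => ~ V (op (inv x) y))).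
- exact: (@is_step2 _ _ _ _ (fun x k => ~ rel x k)).
- exact: (@is_step2 _ _ _ _ (fun k x => ~ phi k x)).
- move=> r /= nV.
  have [[_ relV]|?] := pselect (rel (f r) (nth k0 s (cell n r))); last by left.
  by right=> /relV.
Qed.

(** Grid functions with values enumerated by [phi]; they form the dense subset and also the
    translating sets for both kinds of narrowness. *)
Let cell_steps (phi : K -> G) k0 : set (J R -> G) :=
  [set g | exists n s, g = fun r => phi (nth k0 s (cell n r))].

Let card_cell_steps phi k0 : card_le (cell_steps phi k0) [set: K].
Proof.
apply: (card_le_range_nat_seq
  (g := fun n (_ : nat) s (r : J R) => phi (nth k0 s (cell n r)))) => //.
by move=> _ [n [s ->]]; exists n, 0%N, s.
Qed.

Let cell_steps_Gbul phi k0 : cell_steps phi k0 `<=` Gbul R G.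
Proof. by move=> _ [n [s ->]]; exact: (is_step_cell R n (fun k => phi (nth k0 s k))). Qed.

Lemma dense_bul : dense_card_le K [set: G] open ->
  dense_card_le K (Gbul R G) (open_bul R op e).
Proof.
move=> [D [_ Ddense DK]]; have [_ [G2 _] _ _ _] := gyroG.
have [phi phiD Dphi] : exists2 phi : K -> G, forall k, D (phi k) & D `<=` range phi.
  apply: card_le_enum => //.
  by have [|x [_ Dx]] := Ddense _ openT; [exists e|exists x].
have [k0 _] := infinite_setN0 Kinf.
exists (cell_steps phi k0); split; [exact: cell_steps_Gbul| |exact: card_cell_steps].
move=> U Uop [f Uf]; have sf : is_step f by exact: Uop.1.
have [V [eps [oV Ve eps0 VU]]] := open_bul_nbhd Uop Uf.
(* Density supplies a point of the enumerated set in the open translate x + V. *)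
pose rel x k := V (op (inv x) (phi k)).
have relE x : exists k, rel x k.
  have [||y [Vy Dy]] := Ddense (op (inv x) @^-1` V).
  - exact: open_preimage_op.
  - by exists x; rewrite /preimage /= (G2 x).1.
  - by have [k _ ky] := Dphi _ Dy; exists k; rewrite /rel ky.
have [n [s fs]] := step_cell_choice k0 sf eps0 relE.
exists (fun r => phi (nth k0 s (cell n r))); split; last by exists n, s.
by apply: VU => //; exact: (is_step_cell R n (fun k => phi (nth k0 s k))).
Qed.

Lemma is_nbhd_bul (U : set (J R -> G)) :
  is_nbhd (Gbul R G) (open_bul R op e) (const_bul R e) U ->
  exists V (eps : R), [/\ open V, V e, 0 < eps & forall g, is_step g ->
      (muJ [set r | ~ V (g r)] < eps%:E)%E -> U g].
Proof.
move=> [_ [W Wop [We WU]]].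
have [V [eps [oV Ve eps0 VW]]] := open_bul_nbhd Wop We.
exists V, eps; split => // g sg gV; apply: WU; apply: VW => //.
by under eq_set do rewrite gyro_op_inv_e.
Qed.

(** A grid function g has f(r) in g(r) + V off a small set. The factor u = (-g) + f solves g + u = f
    everywhere and leaves [V] only on that set. *)
Lemma left_narrow_bul : left_narrow K [set: G] open op e ->
  left_narrow K (Gbul R G) (open_bul R op e) (opbul op) (const_bul R e).
Proof.
move=> Gnar U Unb; have UG := Unb.1.
have [V [eps [oV Ve eps0 VU]]] := is_nbhd_bul Unb.
have [|D [_ DK DV]] := Gnar V; first by split;
  [exact: subsetT|exists V => //; split=> //; exact: subset_refl].
have [phi phiD Dphi] : exists2 phi : K -> G, forall k, D (phi k) & D `<=` range phi.
  apply: card_le_enum => //; have : setT e by [].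
  by rewrite -DV => -[x Dx _]; exists x.
have [k0 _] := infinite_setN0 Kinf.
exists (cell_steps phi k0); split; [exact: cell_steps_Gbul|exact: card_cell_steps|].
apply/seteqP; split=> [_ [g /cell_steps_Gbul sg [u /UG su] <-]|f sf].
  exact: is_step2.
pose rel x k := V (op (inv (phi k)) x).
have relE x : exists k, rel x k.
  have : setT x by []. rewrite -DV => -[y Dy [v Vv <-]].
  by have [k _ <-] := Dphi _ Dy; exists k; rewrite /rel (gyroKl gyroG).
have [n [s fs]] := step_cell_choice k0 sf eps0 relE.
exists (fun r => phi (nth k0 s (cell n r))); first by exists n, s.
exists (fun r => op (inv (phi (nth k0 s (cell n r)))) (f r)); last first.
  by apply/funext => r; rewrite /opbul (gyroVKl gyroG).
apply: VU => //; apply: (@is_step2 _ _ _ _ (fun k x => op (inv (phi k)) x)) => //.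
exact: is_step_cell.
Qed.

(** The equation u + g = f must hold at every point, also where no solution lies in [V]; there
    [gyro_div] supplies one. *)
Lemma right_narrow_bul : right_narrow K [set: G] open op e ->
  right_narrow K (Gbul R G) (open_bul R op e) (opbul op) (const_bul R e).
Proof.
move=> Gnar U Unb; have UG := Unb.1.
have [V [eps [oV Ve eps0 VU]]] := is_nbhd_bul Unb.
have [|D [_ DK DV]] := Gnar V; first by split;
  [exact: subsetT|exists V => //; split=> //; exact: subset_refl].
have [phi phiD Dphi] : exists2 phi : K -> G, forall k, D (phi k) & D `<=` range phi.
  apply: card_le_enum => //; have : setT e by [].
  by rewrite -DV => -[x Vx [y Dy _]]; exists y.
have [k0 _] := infinite_setN0 Kinf.
exists (cell_steps phi k0); split; [exact: cell_steps_Gbul|exact: card_cell_steps|].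
apply/seteqP; split=> [_ [u /UG su [g /cell_steps_Gbul sg <-]]|f sf].
  exact: is_step2.
pose rel x k := exists2 v, V v & op v (phi k) = x.
have relE x : exists k, rel x k.
  have : setT x by []. rewrite -DV => -[v Vv [y Dy <-]].
  by have [k _ <-] := Dphi _ Dy; exists k, v.
have [n [s fs]] := step_cell_choice k0 sf eps0 relE.
(* a right quotient x of b by phi k, taken in V whenever possible *)
have quot (bk : G * K) : exists x, op x (phi bk.2) = bk.1 /\ (rel bk.1 bk.2 -> V x).
  have [[v Vv vb]|nrel] := pselect (rel bk.1 bk.2); first by exists v.
  by have [x xb] := gyro_div gyroG (phi bk.2) bk.1; exists x.
have [q qP] := choice quot.
have scell := is_step_cell R n (nth k0 s).
(* One choice function [q] of the pair of values keeps the quotient a step function. *)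
have sq : is_step (fun r => q (f r, nth k0 s (cell n r))).
  exact: (is_step2 (fun x k => q (x, k))).
exists (fun r => q (f r, nth k0 s (cell n r))); last first.
  exists (fun r => phi (nth k0 s (cell n r))); first by exists n, s.
  by apply/funext => r; rewrite /opbul (qP (_, _)).1.
apply: VU => //; apply: le_lt_trans fs; apply: muJ_le.
- exact: (is_step1 (fun x => ~ V x)).
- exact: (@is_step2 _ _ _ _ (fun x k => ~ rel x k)).
- by move=> r /= nV /(qP (_, _)).2.
Qed.

End cardinality.

(** * Metrizability *)

Section metric.
Variable d : G -> G -> R.
Hypothesis d_ge0 : forall x y, 0 <= d x y.
Hypothesis d_eq0 : forall x y, d x y = 0 <-> x = y.
Hypothesis d_sym : forall x y, d x y = d y x.
Hypothesis d_tri : forall x y z, d x z <= d x y + d y z.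
Hypothesis d_open : forall U : set G, open U <->
  forall x, U x -> exists2 r : R, 0 < r & [set y | d x y < r] `<=` U.

(* The Ky Fan metric, which metrizes convergence in measure. *)
Definition kyfan_set (f g : J R -> G) : set R :=
  [set t | 0 <= t /\ (muJ [set r | (t < d (f r) (g r))%R] <= t%:E)%E].

Definition kyfan f g : R := inf (kyfan_set f g).

Let step_gt (f g : J R -> G) (t : R) : is_step f -> is_step g ->
  is_step [set r | t < d (f r) (g r)].
Proof. exact: (@is_step2 _ _ _ _ (fun x y => t < d x y : Prop)). Qed.

Lemma kyfan_set_neq0 (f g : J R -> G) : is_step f -> is_step g -> kyfan_set f g !=set0.
Proof.
move=> sf sg; exists 1; split => //; rewrite -(muJ_setT R).
by apply: muJ_le => //; [exact: step_gt|exact: is_step_cst].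
Qed.

Lemma kyfan_le f g t : kyfan_set f g t -> kyfan f g <= t.
Proof. by apply: ge_inf; exists 0 => u []. Qed.

Lemma kyfan_ge0 (f g : J R -> G) : is_step f -> is_step g -> 0 <= kyfan f g.
Proof.
by move=> sf sg; apply: lb_le_inf; [exact: kyfan_set_neq0|move=> t []].
Qed.

(** If f and g differ at one point, by distance c, the step set where they are at distance at least
    c has measure at least some b > 0. An admissible t < min(b, c) would then give b <= t. *)
Lemma kyfan_eq0 (f g : J R -> G) : is_step f -> is_step g -> kyfan f g = 0 <-> f = g.
Proof.
move=> sf sg; split=> [D0|<-]; last first.
  apply/eqP; rewrite eq_le kyfan_ge0// andbT; apply: kyfan_le; split => //.
  rewrite (_ : mkset _ = set0) ?muJ_set0// -subset0 => r /=.
  by rewrite (d_eq0 _ _).2// ltxx.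
apply/funext => r0; apply/d_eq0/eqP; rewrite eq_le d_ge0 andbT leNgt.
apply/negP => c0; set c := d _ _ in c0.
pose B := [set r | c <= d (f r) (g r)].
have sB : is_step B by exact: (@is_step2 _ _ _ _ (fun x y => c <= d x y : Prop)).
have [b b0 bB] := muJ_pos sB (lexx c : B r0).
have [|t [t0 tE]] := @inf_lt _ (kyfan_set f g) (Num.min b c) (kyfan_set_neq0 sf sg).
  by rewrite -/(kyfan f g) D0 lt_min b0.
rewrite lt_min => /andP[tb tc].
have : (b%:E <= t%:E)%E.
  apply: le_trans bB (le_trans _ tE); apply: muJ_le => //; first exact: step_gt.
  by move=> r /=; exact: lt_le_trans.
by rewrite lee_fin leNgt tb.
Qed.

Lemma kyfan_sym f g : kyfan f g = kyfan g f.
Proof.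
congr inf; apply/funext => t; rewrite /kyfan_set /=.
by under eq_set do rewrite d_sym.
Qed.

(** If d(f,h) > t + u at a point, then d(f,g) > t or d(g,h) > u there, so admissible t and u add up;
    the infima are taken one after the other. *)
Lemma kyfan_tri (f g h : J R -> G) : is_step f -> is_step g -> is_step h ->
  kyfan f h <= kyfan f g + kyfan g h.
Proof.
move=> sf sg sh; rewrite -lerBlDr; apply: lb_le_inf; first exact: kyfan_set_neq0.
move=> t [t0 tE]; rewrite lerBlDr -lerBlDl; apply: lb_le_inf; first exact: kyfan_set_neq0.
move=> u [u0 uE]; rewrite lerBlDl; apply: kyfan_le; split; first exact: addr_ge0.
apply: muJ_cover_le tE uE; try exact: step_gt.
move=> r /= tu; have [?|ft] := ltP t (d (f r) (g r)); [by left|right].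
have := d_tri (f r) (g r) (h r) => ?; rewrite /=; lra.
Qed.

Lemma finite_common_radius (X : set G) (F : G -> set G) : finite_set X ->
  (forall x, exists2 r : R, 0 < r & [set y | d x y < r] `<=` F x) ->
  exists2 r : R, 0 < r & forall x, X x -> [set y | d x y < r] `<=` F x.
Proof.
move=> /finite_seqP[s ->] Fx.
elim: s => [|x s [r r0 rF]]; first by exists 1.
have [r' r'0 r'F] := Fx x.
exists (Num.min r r'); first by rewrite lt_min r0.
move=> y /=; rewrite inE => /predU1P[->|ys] v /=; rewrite lt_min => /andP[vr vr'].
  exact: r'F.
exact: (rF y).
Qed.

Lemma open_bul_kyfan (U : set (J R -> G)) : open_bul R op e U <->
  (U `<=` Gbul R G /\ forall f, U f -> exists2 r : R, 0 < r &
     [set g | Gbul R G g /\ kyfan f g < r] `<=` U).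
Proof.
have [[G1 _] [G2 _] _ _ _] := gyroG.
split=> [Uop|[UG Uball]].
  split=> [|f Uf]; first exact: Uop.1.
  have sf : is_step f by exact: Uop.1.
  have [V [eps [oV Ve eps0 VU]]] := open_bul_nbhd Uop Uf.
  have [|c c0 cV] := finite_common_radius (F := fun x => op (inv x) @^-1` V)
      (is_step_finite_range sf).
    move=> x; apply: (d_open _).1; first exact: open_preimage_op.
    by rewrite /preimage /= (G2 x).1.
  (* An admissible t < min(c, eps) bounds the measure of the points where g leaves f + V, since at
     those points d(f,g) >= c > t. *)
  exists (Num.min c eps); first by rewrite lt_min c0.
  move=> g [sg]; move=> /(inf_lt (kyfan_set_neq0 sf sg))[t [t0 tE]].
  rewrite lt_min => /andP[tc te]; apply: VU => //.
  apply: (@le_lt_trans _ _ t%:E); last by rewrite lte_fin.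
  apply: le_trans tE; apply: muJ_le; last 1 first.
  - move=> r /= nV; rewrite ltNge; apply/negP => dt; apply: nV.
    by apply: (cV (f r)); [exists r|exact: le_lt_trans tc].
  - exact: (@is_step2 _ _ _ _ (fun x y => ~ V (op (inv x) y))).
  - exact: step_gt.
split => // f Uf; have sf : is_step f by exact: UG.
have [r r0 rU] := Uball f Uf.
have dball x : open [set y | d x y < r / 2].
  apply/d_open => y /= xy; exists (r / 2 - d x y); first by rewrite subr_gt0.
  by move=> z /= yz; have := d_tri x y z => ?; lra.
(* Translates of [V] by the finitely many values of [f] stay within r/2 of those values. Then r/2 is
   admissible, and halving keeps the infimum strictly below r. *)
have [|V [oV Ve VF]] := finite_common_nbhd
    (F := fun x => op x @^-1` [set y | d x y < r / 2]) (is_step_finite_range sf).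
  move=> x; split; first exact: open_preimage_op.
  by rewrite /preimage /= (G1 x).2 (d_eq0 _ _).2// divr_gt0.
have r20 : 0 < r / 2 by rewrite divr_gt0.
exists V, (r / 2) => // _ [h [sh hV] <-].
have sfh : is_step (opbul op f h) by exact: is_step2.
apply: rU; split => //; apply: (@le_lt_trans _ _ (r / 2)); last by lra.
apply: kyfan_le; split; first exact: ltW.
apply: le_trans (ltW hV); apply: muJ_le.
- exact: step_gt.
- exact: (is_step1 (fun x => ~ V x)).
- move=> s /= ds Vh; have /(_ (ex_intro2 _ _ s I erefl) (h s) Vh) := VF (f s).
  by rewrite /preimage /= ltNge (ltW ds).
Qed.

End metric.

Lemma metrizable_bul : metrizable_sp R [set: G] open ->
  metrizable_sp R (Gbul R G) (open_bul R op e).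
Proof.
move=> [d [d_ge0 d_eq0 d_sym d_tri d_open]].
have dE U : open U <->
    forall x, U x -> exists2 r : R, 0 < r & [set y | d x y < r] `<=` U.
  rewrite d_open; split=> [[_ H] x /H[r r0 rU]|H].
    by exists r => // y yr; exact: rU.
  by split=> // x /H[r r0 rU]; exists r => // y [_]; exact: rU.
exists (kyfan d); split.
- by move=> f g sf sg; apply: kyfan_ge0.
- by move=> f g sf sg; apply: kyfan_eq0 => // x y; [exact: d_ge0|exact: d_eq0].
- by move=> f g _ _; apply: kyfan_sym => x y; exact: d_sym.
- by move=> f g h sf sg sh; apply: kyfan_tri => // x y z; exact: d_tri.
- move=> U; apply: open_bul_kyfan => //.
  + by move=> x y; exact: d_eq0.
  + by move=> x y z; exact: d_tri.
Qed.

End topological_gyrogroup.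

Theorem mainTheorem10 (R : realType) (K : Type) (G : topologicalType)
  (op : G -> G -> G) (e : G) (inv : G -> G) (gyr : G -> G -> G -> G) :
  infinite_set [set: K] ->
  is_topological_gyrogroup op e inv gyr ->
  [/\ metrizable_sp R [set: G] open ->
        metrizable_sp R (Gbul R G) (open_bul R op e),
      local_base_card_le K open e ->
        local_base_card_le K (open_bul R op e) (const_bul R e),
      network_card_le K (@open G) ->
        network_card_le K (open_bul R op e),
      dense_card_le K [set: G] open ->
        dense_card_le K (Gbul R G) (open_bul R op e) &
      narrow K [set: G] open op e ->
        narrow K (Gbul R G) (open_bul R op e) (opbul op) (const_bul R e)].
Proof.
move=> Kinf topG; split.
- exact: metrizable_bul topG.
- exact: (local_base_bul R topG Kinf).
- exact: (network_bul R topG Kinf).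
- exact: (dense_bul R topG Kinf).
- by move=> [lK rK]; split;
    [exact: (left_narrow_bul topG Kinf lK)|exact: (right_narrow_bul topG Kinf rK)].
Qed.
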